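(* Let $0\le \ell<u$, let $f:[\ell,u]\to\mathbb{R}_{++}$ be convex, and let $\ell=:\xi_0<\xi_1<\cdots<\xi_n:=u$ ($n\ge 1$) be linearization points at which $f$ is differentiable. Let $\breve{U}^*_f(\boldsymbol\xi)$ be as defined in the context. Assuming oracle access to $f$ and $f'$, we can compute $\operatorname{vol}(\breve{U}^*_f(\boldsymbol\xi))$ in $\mathcal{O}(n)$ time.
   Context: Given $f$ and $\boldsymbol\xi=(\xi_0,\ldots,\xi_n)$, put $\tau_0:=\ell$, $\tau_{n+1}:=u$ and, for $i=1,\ldots,n$, $$\tau_i:=\frac{[f(\xi_i)-f'(\xi_i)\xi_i]-[f(\xi_{i-1})-f'(\xi_{i-1})\xi_{i-1}]}{f'(\xi_{i-1})-f'(\xi_i)},$$ the abscissa of the intersection point of the tangent lines to $f$ at $\xi_{i-1}$ and $\xi_i$. Let $P_0:=(\ell,f(\ell))$, $P_{n+1}:=(u,f(u))$ and $P_i:=(\tau_i,\ f(\xi_i)+f'(\xi_i)(\tau_i-\xi_i))$ for $i=1,\ldots,n$. Then $g:[\ell,u]\to\mathbb{R}$ is the piecewise-linear function whose graph connects $P_0,P_1,\ldots,P_{n+1}$ in this order (a convex under-estimator of $f$ agreeing with $f$ at the $\xi_i$). The set $\breve{U}^*_f(\boldsymbol\xi)$ is the perspective relaxation associated with $g$, that is, with $s:=\frac{g(u)-g(\ell)}{u-\ell}$, the convex closure of $$\left\{(x,y,z)\in\mathbb{R}^3:\ (g(\ell)-s\ell)z+sx\ge y\ge z\,g(x/z),\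 uz\ge x\ge \ell z,\ 1\ge z>0,\ y\ge 0\right\}.$$ $\operatorname{vol}$ denotes 3-dimensional volume.
   Formalization: When f' takes equal values at ξ_{i-1} and ξ_i, the formula for τ_i is 0/0 and the tangents coincide; τ_i is then taken to be the midpoint of ξ_{i-1} and ξ_i, which gives the same g as any other point between them. *)

(* Defs.v *)
From HB Require Import structures.
From mathcomp Require Import all_boot all_order all_algebra.
From mathcomp Require Import all_classical all_reals all_analysis.
Set Implicit Arguments.
Unset Strict Implicit.
Unset Printing Implicit Defensive.
Import Order.TTheory GRing.Theory Num.Theory.
Import numFieldNormedType.Exports.
Local Open Scope classical_set_scope.
Local Open Scope ring_scope.

(* f has derivative d at x as a function on the domain D: at an endpoint of an
   interval D this is the one-sided derivative, and values of f outside D are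
   irrelevant. *)
Definition is_derive_on (R : realType) (D : set R) (f : R -> R) (x d : R) : Prop :=
  (f y - f x) / (y - x) @[y --> within D x^'] --> d.

Section PiecewiseLinear.
Variable R : realType.

(* When f' takes the same value at xi_{i-1} and xi_i, the two tangent lines
   coincide (f being convex) and every abscissa between xi_{i-1} and xi_i gives
   the same graph; the midpoint is chosen, so that the breakpoints are always
   strictly increasing. *)
Definition tau (l u : R) (f f' : R -> R) (n : nat) (xi : nat -> R) (i : nat) : R :=
  if i == 0%N then l
  else if (n < i)%N then u
  else if f' (xi i.-1) == f' (xi i) then (xi i.-1 + xi i) / 2
  else ((f (xi i) - f' (xi i) * xi i)
        - (f (xi i.-1) - f' (xi i.-1) * xi i.-1))
       / (f' (xi i.-1) - f' (xi i)).

Definition node (l u : R) (f f' : R -> R) (n : nat) (xi : nat -> R) (i : nat) : R * R :=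
  if i == 0%N then (l, f l)
  else if (n < i)%N then (u, f u)
  else let t := tau l u f f' n xi i in
       (t, f (xi i) + f' (xi i) * (t - xi i)).

(* The function whose graph connects the points of s (with increasing
   abscissae) in order; values outside the range of abscissae are junk. *)
Fixpoint polyline (s : seq (R * R)) (x : R) : R :=
  if s is p :: s' then
    if s' is q :: _ then
      if x <= q.1 then p.2 + (q.2 - p.2) / (q.1 - p.1) * (x - p.1)
      else polyline s' x
    else p.2
  else 0.

Definition under_estimator (l u : R) (f f' : R -> R) (n : nat) (xi : nat -> R) : R -> R :=
  polyline [seq node l u f f' n xi i | i <- iota 0%N n.+2].

End PiecewiseLinear.

Section Perspective.
Variable R : realType.

Definition perspective_set (l u : R) (g : R -> R) : set (R * R * R) :=
  let s := (g u - g l) / (u - l) in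
  [set p | let: (x, y, z) := p in
    [/\ z * g (x / z) <= y <= (g l - s * l) * z + s * x,
        l * z <= x <= u * z,
        0 < z <= 1 &
        0 <= y]].

Definition convex_closure (A : set (R * R * R)) : set (R * R * R) :=
  closure (smallest (@convex_set R (R * R * R)%type) A).

Definition U_relax (l u : R) (f f' : R -> R) (n : nat) (xi : nat -> R) :
    set (R * R * R) :=
  convex_closure (perspective_set l u (under_estimator l u f f' n xi)).

Definition vol (A : set (R * R * R)) : \bar R :=
  ((@lebesgue_measure R \x @lebesgue_measure R) \x @lebesgue_measure R)%E A.

End Perspective.

(* A real RAM with two oracles. It has index registers holding natural numbers,
   real registers, and an array of reals addressed through the index registers.
   A program mentions finitely many registers and no real constants other than
   natural numbers. Every instruction, oracle queries included, costs one step.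
   Below, i j k are index registers, a b c real registers, m a literal and t a
   jump target. *)
Inductive instr : Type :=
  | ISet (i m : nat)
  | IAdd (i j k : nat)
  | ISub (i j k : nat)
  | IJumpLe (i j t : nat)
  | RSet (a m : nat)
  | RAdd (a b c : nat)
  | RSub (a b c : nat)
  | RMul (a b c : nat)
  | RDiv (a b c : nat)
  | RJumpLe (a b t : nat)
  | MRead (a i : nat)
  | MWrite (i a : nat)
  | QueryF (a b : nat)
  | QueryF' (a b : nat)
  | Halt.

Definition program := seq instr.

Section RealRAM.
Variable R : realType.

Record state := State {
  pc : nat;
  ireg : nat -> nat;
  rreg : nat -> R;
  mem : nat -> R }.

Definition set_ireg (i v : nat) (st : state) : state :=
  State (pc st).+1 [eta ireg st with i |-> v] (rreg st) (mem st).
Definition set_rreg (a : nat) (v : R) (st : state) : state :=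
  State (pc st).+1 (ireg st) [eta rreg st with a |-> v] (mem st).
Definition set_mem (k : nat) (v : R) (st : state) : state :=
  State (pc st).+1 (ireg st) (rreg st) [eta mem st with k |-> v].
Definition jump_if (b : bool) (t : nat) (st : state) : state :=
  State (if b then t else (pc st).+1) (ireg st) (rreg st) (mem st).

(* None: the machine does not move, because it has halted, divides by zero, or
   has left the program. Index subtraction is truncated. *)
Definition step (f f' : R -> R) (P : program) (st : state) : option state :=
  let I := ireg st in
  let X := rreg st in
  match onth P (pc st) with
  | Some (ISet i m) => Some (set_ireg i m st)
  | Some (IAdd i j k) => Some (set_ireg i (I j + I k)%N st)
  | Some (ISub i j k) => Some (set_ireg i (I j - I k)%N st)
  | Some (IJumpLe i j t) => Some (jump_if (I i <= I j)%N t st)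
  | Some (RSet a m) => Some (set_rreg a m%:R st)
  | Some (RAdd a b c) => Some (set_rreg a (X b + X c) st)
  | Some (RSub a b c) => Some (set_rreg a (X b - X c) st)
  | Some (RMul a b c) => Some (set_rreg a (X b * X c) st)
  | Some (RDiv a b c) =>
      if X c == 0 then None else Some (set_rreg a (X b / X c) st)
  | Some (RJumpLe a b t) => Some (jump_if (X a <= X b) t st)
  | Some (MRead a i) => Some (set_rreg a (mem st (I i)) st)
  | Some (MWrite i a) => Some (set_mem (I i) (X a) st)
  | Some (QueryF a b) => Some (set_rreg a (f (X b)) st)
  | Some (QueryF' a b) => Some (set_rreg a (f' (X b)) st)
  | Some Halt => None
  | None => None
  end.

Fixpoint run (f f' : R -> R) (P : program) (k : nat) (st : state) : option state :=
  if k is k'.+1 then obind (run f f' P k') (step f f' P st) else Some st.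

(* The input is n in index register 0 and xi_0, ..., xi_n in the array; all
   other cells are 0. *)
Definition init (n : nat) (xi : nat -> R) : state :=
  State 0%N [eta fun=> 0%N with 0%N |-> n] (fun=> 0)
    (fun k => if (k <= n)%N then xi k else 0).

(* P halts after at most T steps with v in real register 0. *)
Definition computes_within (f f' : R -> R) (P : program) (n : nat)
    (xi : nat -> R) (T : nat) (v : R) : Prop :=
  exists k st, [/\ (k <= T)%N, run f f' P k (init n xi) = Some st,
    onth P (pc st) = Some Halt & rreg st 0%N = v].

End RealRAM.

(* Main.v *)
From HB Require Import structures.
Require Import Defs.
From mathcomp Require Import all_boot all_order all_algebra.
From mathcomp Require Import all_classical all_reals all_analysis.
From mathcomp Require Import measurable_realfun.
From mathcomp Require Import ring lra.
Import Order.TTheory GRing.Theory Num.Theory.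
Import numFieldNormedType.Exports.
Local Open Scope classical_set_scope.
Local Open Scope ring_scope.

(** The relaxation is a cone over a planar region.  Convexity and the
    derivatives at the [xi i] say that the tangent lines at these points lie
    below [f] ([tangent_below]), and from this alone the breakpoints
    [tau i] interlace with the [xi i], so that the under-estimator [g] is the
    maximum of the tangents ([under_estimator_tangent], [tangent_max]).
    Substituting this in the perspective set turns it into finitely many linear
    inequalities together with [0 < z] ([perspective_setE]): it is convex, and
    closing it can only add its apex, the origin.

    The slice of the relaxation at height [z] is the region between the chord of
    [f] and [max (g, 0)], dilated by [z].  Its area is thus [z ^ 2] times that of
    the slice at height 1, and integrating over [z] between 0 and 1 gives a third
    of the latter ([volume_U_relax]).

    The cut [y >= 0] does matter: [f] is positive, but two of its tangents may
    well meet below the axis.  So the area has to be that under [max (g, 0)].  It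
    is the sum over the cells between two consecutive [xi i] of an explicit
    expression in the values and slopes at the two ends: on such a cell [g]
    follows one tangent from a positive value to the crossing point, and another
    one back to a positive value, so each half is a trapezoid or a triangle,
    depending on the sign at the crossing point ([has_int_cell]).

    The program visits the cells once, with a bounded number of instructions for
    each, and accumulates these expressions.  Its correctness is an invariant at
    the head of the loop ([reach_head_next]).  The program and the volume are
    related through the common expression [cell_area2]. *)

(** * Tangents of a convex function *)

(** By convexity the chord slope of [f] from [x] towards [y] does not exceed the
    one from [x] to [y], however close to [x] its other end is taken; the
    derivative is the limit of such slopes. *)
Lemma tangent_below (R : realType) (l u : R) (f : R -> R) (x d y : R) :
  convex_function (`[l, u] : set R) f -> is_derive_on `[l, u] f x d ->
  x \in `[l, u] -> y \in `[l, u] -> f x + d * (y - x) <= f y.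
Proof.
move=> fconv fder xlu ylu; rewrite leNgt; apply/negP => hlt.
have yx : y - x != 0.
  by apply/eqP => h0; move: hlt; rewrite h0 mulr0 addr0 (_ : x = y) ?ltxx//; lra.
have ngt0 : 0 < `|y - x| by rewrite normr_gt0.
pose e := (f x + d * (y - x) - f y) / `|y - x|.
have e0 : 0 < e by rewrite divr_gt0// subr_gt0.
have /cvgrPdist_lt/(_ e e0) := fder.
rewrite near_withinE near_withinE => /nbhs_ballP[r /= r0 rP].
(* a point [x + t (y - x)] that is at distance less than [r] from [x] *)
pose t := Num.min 1 (r / (2 * `|y - x|)).
have t0 : 0 < t by rewrite lt_min ltr01 divr_gt0// mulr_gt0.
have t1 : t <= 1 by rewrite ge_min lexx.
have tr : t * `|y - x| < r.
  have : t * `|y - x| <= r / (2 * `|y - x|) * `|y - x|.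
    by rewrite ler_wpM2r// ge_min lexx orbT.
  rewrite (_ : r / (2 * `|y - x|) * `|y - x| = r / 2); first by lra.
  by field; rewrite lt0r_neq0.
pose w := x + t * (y - x).
have wx : w - x = t * (y - x) by rewrite /w; ring.
have wlu : w \in `[l, u].
  move: xlu ylu; rewrite !in_itv/= => /andP[lx xu] /andP[ly yu].
  apply/andP; split; rewrite /w; nra.
have := rP w.
rewrite -ball_normE /ball_ /= distrC wx normrM (gtr0_norm t0) => /(_ tr).
have wnx : w != x by rewrite -subr_eq0 wx mulf_neq0// gt_eqF.
move=> /(_ wnx) /(_ wlu) hq.
have cv : f w <= t * f y + (1 - t) * f x.
  have t01 : 0 <= t <= 1 by rewrite (ltW t0).
  have := fconv (Itv01 (ltW t0) t1) y x; rewrite !inE.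
  move=> /(_ ylu xlu).
  change (f (t * y + (1 - t) * x) <= t * f y + (1 - t) * f x ->
          f w <= t * f y + (1 - t) * f x).
  by rewrite (_ : t * y + (1 - t) * x = w)// /w; ring.
have key : (f w - f x) / (t * (y - x)) * (y - x) <= f y - f x.
  rewrite (_ : (f w - f x) / (t * (y - x)) * (y - x) = (f w - f x) / t);
    last by field; rewrite yx gt_eqF.
  by rewrite ler_pdivrMr//; lra.
have : `|(d - (f w - f x) / (t * (y - x))) * (y - x)| < e * `|y - x|.
  by rewrite normrM ltr_pM2r.
rewrite /e divfK ?gt_eqF// ltr_norml => /andP[_].
rewrite mulrBl; lra.
Qed.

(** * Integrals of piecewise affine functions *)

(** Twice the area under the positive part of an affine function that goes from
    [p > 0] to [v] over a length [w]: a trapezoid, or the triangle of base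
    [w * p / (p - v)]. *)
Definition ramp_area2 {R : realType} (w p v : R) : R :=
  if 0 <= v then w * (p + v) else w * (p * p) / (p - v).

(** Twice the area under the positive part of the larger of two affine functions
    on [[x0, x1]]: one of value [f0] at [x0] and slope [m0], the other of value
    [f1] at [x1] and slope [m1].  They are meant to be tangents of a convex
    function, so that [m1 <= m0] means that they coincide; otherwise they cross
    at the point [(t, v)].  The program evaluates exactly this expression. *)
Definition cell_area2 {R : realType} (x0 f0 m0 x1 f1 m1 : R) : R :=
  if m1 <= m0 then (x1 - x0) * (f0 + f1)
  else
    let t := ((f1 - m1 * x1) - (f0 - m0 * x0)) / (m0 - m1) in
    let v := f1 + m1 * (t - x1) in
    ramp_area2 (t - x0) f0 v + ramp_area2 (x1 - t) f1 v.

Section PiecewiseAffineIntegral.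
Variable R : realType.
Implicit Types (h : R -> R) (a b c p q k : R).
Local Notation mu := (@lebesgue_measure R).

(** Measurability is carried along because adjoining two intervals needs it. *)
Definition has_int h a b (v : R) : Prop :=
  measurable_fun `[a, b] h /\
  (\int[mu]_(x in `[a, b]) (h x)%:E)%E = v%:E.

Lemma has_int_quadratic h a b p q r : a <= b ->
  (forall x, a <= x <= b -> h x = p + q * x + r * x ^+ 2) ->
  has_int h a b
    (p * (b - a) + q * (b ^+ 2 - a ^+ 2) / 2 + r * (b ^+ 3 - a ^+ 3) / 3).
Proof.
move=> ab hE.
pose H x := p + q * x + r * x ^+ 2.
have cH : continuous H.
  by move=> x; apply/differentiable_continuous/derivable1_diffP.
split.
  apply: (eq_measurable_fun H).
    by move=> x; rewrite inE/= in_itv/= => xab; rewrite hE.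
  exact: measurable_funTS (continuous_measurable_fun cH).
move: ab; rewrite le_eqVlt => /predU1P[<-|ab].
  by rewrite set_itv1 integral_set1; congr EFin; ring.
transitivity (\int[mu]_(x in `[a, b]) (H x)%:E)%E.
  by apply: eq_integral => x; rewrite inE/= in_itv/= => xab; rewrite hE.
pose F x := p * x + q * x ^+ 2 / 2 + r * x ^+ 3 / 3.
have dF (x : R) : is_derive x 1 F (H x).
  by rewrite /F; apply: is_derive_eq; rewrite /H /GRing.scale/=; field.
have cF : continuous F.
  by move=> x; apply/differentiable_continuous/derivable1_diffP.
rewrite (@continuous_FTC2 _ _ F)//.
- by rewrite -EFinB; congr EFin; rewrite /F; field.
- exact: continuous_subspaceT.
- split; first by move=> x _.
    by apply: cvg_at_right_filter; exact: cF.
  by apply: cvg_at_left_filter; exact: cF.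
- by move=> x _; rewrite derive1E derive_val.
Qed.

Lemma has_int_affine h a b p q : a <= b ->
  (forall x, a <= x <= b -> h x = p + q * x) ->
  has_int h a b (p * (b - a) + q * (b ^+ 2 - a ^+ 2) / 2).
Proof.
move=> ab hE.
rewrite [X in has_int _ _ _ X](_ : _ = p * (b - a)
  + q * (b ^+ 2 - a ^+ 2) / 2 + 0 * (b ^+ 3 - a ^+ 3) / 3); last by field.
by apply: has_int_quadratic => // x xab; rewrite hE// mul0r addr0.
Qed.

Lemma has_int_cat h a b c v w : a <= b -> b <= c ->
  has_int h a b v -> has_int h b c w -> has_int h a c (v + w).
Proof.
move=> ab bc [mv iv] [mw iw].
have acE : `[a, c]%classic = `[a, b] `|` `]b, c] :> set R.
  by rewrite -itv_bndbnd_setU// bnd_simp.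
have mw' : measurable_fun `]b, c] h.
  by apply: measurable_funS mw => //; exact: subset_itv_oc_cc.
have mac : measurable_fun (`[a, b] `|` `]b, c]) h by apply/measurable_funU.
split; first by rewrite acE.
rewrite acE integral_setU//; last 2 first.
- exact/measurable_EFinP.
- rewrite disj_set2E; apply/eqP/seteqP; split => // x [] /=.
  rewrite !in_itv/= => /andP[_ xb] /andP[bx _].
  by move: (lt_le_trans bx xb); rewrite ltxx.
rewrite integral_itv_obnd_cbnd; last exact/measurable_EFinP.
by rewrite iv iw EFinD.
Qed.

Lemma affine_ge0 c k a b x : 0 <= c + k * a -> 0 <= c + k * b ->
  a <= x <= b -> 0 <= c + k * x.
Proof. by move=> La Lb /andP[ax xb]; have [k0|k0] := leP 0 k; nra. Qed.

Lemma ramp_area2_scale z w p v : 0 < z ->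
  ramp_area2 (z * w) (z * p) (z * v) = z ^+ 2 * ramp_area2 w p v.
Proof.
move=> z0; rewrite /ramp_area2 pmulr_rge0//; case: ifP => _; first by ring.
have [pv|pv] := eqVneq p v; first by rewrite pv !subrr !(invr0, mulr0).
have pv0 : p - v != 0 by rewrite subr_eq0.
have zpv0 : z * p - z * v != 0 by rewrite -mulrBr mulf_neq0// gt_eqF.
by field; rewrite ?pv0 ?zpv0.
Qed.

(** If [c + k x] becomes negative on [[a, b]], the maximum switches at its root,
    and the integrand is affine on either side. *)
Lemma has_int_ramp_right h a b p q c k : a <= b -> 0 < c + k * a ->
  (forall x, a <= x <= b -> h x = p + q * x - Num.max 0 (c + k * x)) ->
  has_int h a b (p * (b - a) + q * (b ^+ 2 - a ^+ 2) / 2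
                 - ramp_area2 (b - a) (c + k * a) (c + k * b) / 2).
Proof.
move=> ab La hE; rewrite /ramp_area2; case: ifPn => [Lb|].
  rewrite [X in has_int _ _ _ X](_ : _ =
    (p - c) * (b - a) + (q - k) * (b ^+ 2 - a ^+ 2) / 2); last by field.
  apply: has_int_affine => // x xab.
  by rewrite hE// max_r; [ring|apply: affine_ge0 xab => //; exact: ltW].
rewrite -ltNge => Lb.
have ltab : a < b.
  by rewrite lt_neqAle ab andbT; apply/eqP => eab; move: Lb; rewrite -eab; lra.
have k0 : k < 0 by nra.
have kE : k != 0 by rewrite lt_eqF.
pose r := - c / k.
have rE : c + k * r = 0 by rewrite /r; field.
have ar : a <= r by nra.
have rb : r <= b by nra.
rewrite [X in has_int _ _ _ X](_ : _ =
  ((p - c) * (r - a) + (q - k) * (r ^+ 2 - a ^+ 2) / 2) +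
  (p * (b - r) + q * (b ^+ 2 - r ^+ 2) / 2)); last first.
  rewrite (_ : c + k * a - (c + k * b) = - k * (b - a)); last by ring.
  by rewrite /r; field; rewrite kE subr_eq0 gt_eqF.
apply: (has_int_cat _ _ _ _ _ _ ar rb).
  apply: has_int_affine => // x /andP[ax xr].
  by rewrite hE ?ax ?(le_trans xr)// max_r; [ring|nra].
apply: has_int_affine => // x /andP[rx xb].
by rewrite hE ?xb ?(le_trans ar)// max_l; [ring|nra].
Qed.

(** The mirror image of [has_int_ramp_right]: the positive end is on the right. *)
Lemma has_int_ramp_left h a b p q c k : a <= b -> 0 < c + k * b ->
  (forall x, a <= x <= b -> h x = p + q * x - Num.max 0 (c + k * x)) ->
  has_int h a b (p * (b - a) + q * (b ^+ 2 - a ^+ 2) / 2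
                 - ramp_area2 (b - a) (c + k * b) (c + k * a) / 2).
Proof.
move=> ab Lb hE; rewrite /ramp_area2; case: ifPn => [La|].
  rewrite [X in has_int _ _ _ X](_ : _ =
    (p - c) * (b - a) + (q - k) * (b ^+ 2 - a ^+ 2) / 2); last by field.
  apply: has_int_affine => // x xab.
  by rewrite hE// max_r; [ring|apply: affine_ge0 xab => //; exact: ltW].
rewrite -ltNge => La.
have ltab : a < b.
  by rewrite lt_neqAle ab andbT; apply/eqP => eab; move: La; rewrite eab; lra.
have k0 : 0 < k by nra.
have kE : k != 0 by rewrite gt_eqF.
pose r := - c / k.
have rE : c + k * r = 0 by rewrite /r; field.
have ar : a <= r by nra.
have rb : r <= b by nra.
rewrite [X in has_int _ _ _ X](_ : _ =
  (p * (r - a) + q * (r ^+ 2 - a ^+ 2) / 2) +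
  ((p - c) * (b - r) + (q - k) * (b ^+ 2 - r ^+ 2) / 2)); last first.
  rewrite (_ : c + k * b - (c + k * a) = k * (b - a)); last by ring.
  by rewrite /r; field; rewrite kE subr_eq0 gt_eqF.
apply: (has_int_cat _ _ _ _ _ _ ar rb).
  apply: has_int_affine => // x /andP[ax xr].
  by rewrite hE ?ax ?(le_trans xr)// max_l; [ring|nra].
apply: has_int_affine => // x /andP[rx xb].
by rewrite hE ?xb ?(le_trans ar)// max_r; [ring|nra].
Qed.

End PiecewiseAffineIntegral.

Arguments has_int {R}.

(** * Slicing a product measure *)

Section Slices.
Local Open Scope ereal_scope.

Lemma product_measure_swap (d1 d2 : measure_display) (T1 : measurableType d1)
    (T2 : measurableType d2) (R : realType)
    (m1 : {sigma_finite_measure set T1 -> \bar R})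
    (m2 : {sigma_finite_measure set T2 -> \bar R}) (A : set (T1 * T2)) :
  measurable A -> (m1 \x m2) A = (m1 \x^ m2) A.
Proof.
apply: product_measure_unique => B C mB mC.
exact: product_measure2E.
Qed.

Variables (d : measure_display) (T : measurableType d) (R : realType).
Variable m : {sigma_finite_measure set T -> \bar R}.

(** The product of a sigma-finite measure with itself, as a sigma-finite measure:
    with it, the exchange of the two integrals also slices a triple product along
    its last coordinate. *)
Definition square_measure : {sigma_finite_measure set (T * T)%type -> \bar R} :=
  HB.pack (m \x m)
    (lebesgue_integral_fubini.measure_function_Measure_isSigmaFinite__to__measure_function_isSigmaFinite m m)
    (lebesgue_integral_fubini.measure_function_Measure_isSigmaFinite__to__measure_function_isSFinite m m).

Lemma cube_measure_slices (A : set (T * T * T)%type) : measurable A ->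
  ((m \x m) \x m) A = \int[m]_z (m \x m) (ysection A z).
Proof. exact: (@product_measure_swap _ _ _ _ R square_measure m A). Qed.

Lemma measurable_slices (A : set (T * T * T)%type) : measurable A ->
  measurable_fun setT (fun z => (m \x m) (ysection A z)).
Proof. exact: (@measurable_fun_ysection _ _ _ _ R square_measure A). Qed.

End Slices.

(** * The under-estimator as a maximum of tangents *)

Section Linearization.
Variables (R : realType) (l u : R) (f f' : R -> R) (n : nat) (xi : nat -> R).

Definition tangent (i : nat) (x : R) : R := f (xi i) + f' (xi i) * (x - xi i).

Local Notation tau := (tau l u f f' n xi).
Local Notation node := (node l u f f' n xi).
Local Notation g := (under_estimator l u f f' n xi).

Hypothesis xi0 : xi 0%N = l.
Hypothesis xin : xi n = u.
Hypothesis xi_lt : forall i, (i < n)%N -> xi i < xi i.+1.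
Hypothesis tangent_le : forall i j, (i <= n)%N -> (j <= n)%N ->
  tangent i (xi j) <= f (xi j).

Lemma tangent_xi i : tangent i (xi i) = f (xi i).
Proof. by rewrite /tangent subrr mulr0 addr0. Qed.

Lemma slope_le i : (i < n)%N -> f' (xi i) <= f' (xi i.+1).
Proof.
move=> i_n; have := xi_lt _ i_n.
have := tangent_le i i.+1 (ltnW i_n) i_n.
have := tangent_le i.+1 i i_n (ltnW i_n).
rewrite /tangent => *; nra.
Qed.

(** The crossing point of two consecutive tangents is [tau i.+1].  When they have
    the same slope they coincide, and both sides vanish. *)
Lemma tangentB i x : (i < n)%N ->
  tangent i.+1 x - tangent i x =
  (f' (xi i.+1) - f' (xi i)) * (x - tau i.+1).
Proof.
move=> i_n; have := xi_lt _ i_n.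
have := tangent_le i i.+1 (ltnW i_n) i_n.
have := tangent_le i.+1 i i_n (ltnW i_n).
rewrite /tangent /Defs.tau/= ltnNge i_n/=.
case: ifPn => [/eqP ->|neq] *; first by nra.
by field; rewrite subr_eq0.
Qed.

Lemma tau_itv i : (i < n)%N -> xi i <= tau i.+1 <= xi i.+1.
Proof.
move=> i_n; have := xi_lt _ i_n.
have [eq|neq] := eqVneq (f' (xi i)) (f' (xi i.+1)).
  by rewrite /Defs.tau/= ltnNge i_n/= eq eqxx => *; apply/andP; split; lra.
have slope_gt0 : 0 < f' (xi i.+1) - f' (xi i).
  by rewrite subr_gt0 lt_neqAle neq slope_le.
move=> _; apply/andP; split.
  rewrite -subr_le0 -(pmulr_rle0 _ slope_gt0) -tangentB// subr_le0 tangent_xi.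
  exact: tangent_le (ltnW i_n).
rewrite -subr_ge0 -(pmulr_rge0 _ slope_gt0) -tangentB// subr_ge0 tangent_xi.
exact: tangent_le (ltnW i_n) i_n.
Qed.

Lemma tau0 : tau 0 = l. Proof. by []. Qed.

Lemma tauSn : tau n.+1 = u.
Proof. by rewrite /Defs.tau/= ltnSn. Qed.

Lemma tau_le_xi i : (i <= n)%N -> tau i <= xi i.
Proof. by case: i => [_|i /tau_itv/andP[]//]; rewrite tau0 xi0. Qed.

Lemma xi_le_tauS i : (i <= n)%N -> xi i <= tau i.+1.
Proof.
rewrite leq_eqVlt => /predU1P[->|/tau_itv/andP[]//].
by rewrite tauSn xin.
Qed.

Lemma tau_nondecreasing i j : (i <= j)%N -> (j <= n.+1)%N -> tau i <= tau j.
Proof.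
move=> + jn; elim: j jn => [|j ih] jn; first by rewrite leqn0 => /eqP ->.
rewrite leq_eqVlt => /predU1P[->//|ij].
rewrite (le_trans (ih (ltnW jn) ij))// (le_trans (tau_le_xi _ jn))//.
exact: xi_le_tauS.
Qed.

(** By [tangentB], going from a tangent to the next one loses height to the left
    of their crossing point and gains height to the right of it.  As the crossing
    points are ordered, the heights at [x] increase up to [i] and decrease
    afterwards. *)
Lemma tangent_max i j x : (i <= n)%N -> (j <= n)%N ->
  tau i <= x <= tau i.+1 -> tangent j x <= tangent i x.
Proof.
move=> i_n jn /andP[tx xt]; have [ij|/ltnW ji] := leqP i j.
  elim: j ij jn => [|j ih]; first by rewrite leqn0 => /eqP ->.
  rewrite leq_eqVlt => /predU1P[->//|ij] jn.
  apply: le_trans (ih ij (ltnW jn)).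
  rewrite -subr_le0 tangentB// mulr_ge0_le0// ?subr_ge0 ?slope_le// subr_le0.
  by rewrite (le_trans xt)// tau_nondecreasing// (leq_trans jn).
elim: i i_n ji tx {xt} => [|i ih] i_n; first by rewrite leqn0 => /eqP ->.
rewrite leq_eqVlt => /predU1P[->//|ji] tx.
have tx' : tau i <= x by apply: le_trans tx; rewrite tau_nondecreasing// ltnW.
apply: le_trans (ih (ltnW i_n) ji tx') _.
by rewrite -subr_ge0 tangentB// mulr_ge0// ?subr_ge0 ?slope_le// subr_ge0.
Qed.

Lemma node_fst i : (i <= n.+1)%N -> (node i).1 = tau i.
Proof.
by rewrite /Defs.node /Defs.tau; case: (i == 0%N) => //; case: (n < i)%N.
Qed.

Lemma node_tangent i : (i <= n)%N -> (node i).2 = tangent i (node i).1.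
Proof.
rewrite /Defs.node; case: eqP => [-> _/=|_]; first by rewrite -xi0 tangent_xi.
by rewrite ltnNge => ->.
Qed.

Lemma nodeS_tangent i : (i <= n)%N -> (node i.+1).2 = tangent i (node i.+1).1.
Proof.
rewrite leq_eqVlt => /predU1P[->|i_n].
  by rewrite /Defs.node/= ltnSn/= -xin tangent_xi.
rewrite node_tangent//; apply/eqP; rewrite -subr_eq0 tangentB//.
by rewrite (node_fst i.+1) 1?ltnW// subrr mulr0.
Qed.

(** Consecutive breakpoints may coincide; the quotient is then 0 by convention,
    which gives the right value at the only point of the segment. *)
Lemma segment_line (p q : R * R) (a b x : R) :
  p.2 = a + b * p.1 -> q.2 = a + b * q.1 -> p.1 <= x <= q.1 ->
  p.2 + (q.2 - p.2) / (q.1 - p.1) * (x - p.1) = a + b * x.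
Proof.
move=> p2 q2; rewrite p2 q2; have [pq|pq] := eqVneq p.1 q.1.
  by rewrite pq -eq_le => /eqP <-; rewrite (subrr q.1) mulr0 addr0.
by move=> _; field; rewrite subr_eq0 eq_sym.
Qed.

Lemma node_segment k x : (k <= n)%N -> tau k <= x -> x <= tau k.+1 ->
  (node k).2 + ((node k.+1).2 - (node k).2) / ((node k.+1).1 - (node k).1)
    * (x - (node k).1) = tangent k x.
Proof.
move=> kn tx xt.
have tangentE y : tangent k y = f (xi k) - f' (xi k) * xi k + f' (xi k) * y.
  by rewrite /tangent; ring.
rewrite tangentE; apply: segment_line.
- by rewrite node_tangent.
- by rewrite nodeS_tangent.
- by rewrite (node_fst _ (leqW kn)) (node_fst k.+1 kn) tx.
Qed.

(** Stated from an arbitrary node [k] onwards, for the induction on the list of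
    nodes. *)
Lemma polyline_tangent k m x : (k + m)%N = n -> tau k <= x <= u ->
  exists j, [/\ (j <= n)%N, tau j <= x <= tau j.+1 &
    polyline [seq node i | i <- iota k m.+2] x = tangent j x].
Proof.
elim: m k => [|m ih] k km /andP[tx xu].
all: have kn : (k <= n)%N by rewrite -km leq_addr.
all: have segE := node_segment k x kn tx.
  have xt : x <= tau k.+1 by rewrite -(addn0 k) km tauSn.
  exists k; split => //; first by rewrite tx.
  by rewrite /= {1}(node_fst k.+1 kn) xt segE.
have [xt|tx'] := leP x (tau k.+1).
  exists k; split => //; first by rewrite tx.
  by rewrite /= {1}(node_fst k.+1 kn) xt segE.
have [||j [jn jx jE]] := ih k.+1; first by rewrite addSnnS.
  by rewrite (ltW tx') xu.
exists j; split => //; rewrite -jE.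
by rewrite /= {1}(node_fst k.+1 kn) leNgt tx'.
Qed.

Lemma under_estimator_tangent x : l <= x <= u ->
  exists j, [/\ (j <= n)%N, tau j <= x <= tau j.+1 & g x = tangent j x].
Proof. by move=> lxu; apply: polyline_tangent. Qed.

Lemma under_estimator_ge x i : l <= x <= u -> (i <= n)%N -> tangent i x <= g x.
Proof.
by move=> /under_estimator_tangent[j [jn jx ->]] i_n; exact: tangent_max.
Qed.

Lemma under_estimatorE i x : (i <= n)%N -> l <= x <= u ->
  tau i <= x <= tau i.+1 -> g x = tangent i x.
Proof.
move=> i_n lxu ix; apply/le_anti; rewrite under_estimator_ge// andbT.
have [j [jn _ ->]] := under_estimator_tangent _ lxu.
exact: tangent_max.
Qed.

Lemma xi_itv i : (i <= n)%N -> l <= xi i <= u.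
Proof.
have xi_mono j k : (j <= k <= n)%N -> xi j <= xi k.
  elim: k => [|k ih] /andP[]; first by rewrite leqn0 => /eqP ->.
  rewrite leq_eqVlt => /predU1P[->//|jk] kn.
  by rewrite (le_trans (ih _))// ?(ltW (xi_lt _ kn))// -ltnS jk ltnW.
by move=> i_n; rewrite -xi0 -xin !xi_mono// i_n leqnn.
Qed.

(** * The relaxation as a polyhedral cone *)

Hypothesis lu : l < u.
Hypothesis f_gt0 : forall i, (i <= n)%N -> 0 < f (xi i).

Lemma l_itv : l <= l <= u. Proof. by rewrite lexx ltW. Qed.
Lemma u_itv : l <= u <= u. Proof. by rewrite lexx ltW. Qed.

Lemma under_estimator_l : g l = f l.
Proof.
rewrite (under_estimatorE 0)//; first by rewrite -xi0 tangent_xi.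
  exact: l_itv.
by rewrite tau0 lexx -{1}tau0 tau_nondecreasing.
Qed.

Lemma under_estimator_u : g u = f u.
Proof.
rewrite (under_estimatorE n)//; first by rewrite -xin tangent_xi.
  exact: u_itv.
by rewrite tauSn lexx -{2}tauSn tau_nondecreasing.
Qed.

Definition chord_slope : R := (f u - f l) / (u - l).

(** The perspective [z * c (x / z)] of the affine function [c] that interpolates
    [f] at [l] and [u]; as a linear form it also makes sense for [z = 0]. *)
Definition chord (z x : R) : R := (f l - chord_slope * l) * z + chord_slope * x.

Definition persp_tangent (i : nat) (z x : R) : R :=
  (f (xi i) - f' (xi i) * xi i) * z + f' (xi i) * x.

Lemma persp_tangentE i z x : z != 0 ->
  persp_tangent i z x = z * tangent i (x / z).
Proof. by move=> z0; rewrite /persp_tangent /tangent; field. Qed.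

Lemma chord_l z : chord z (l * z) = f l * z.
Proof. by rewrite /chord; ring. Qed.

Lemma chord_u z : chord z (u * z) = f u * z.
Proof. by rewrite /chord /chord_slope; field; rewrite subr_eq0 gt_eqF. Qed.

Lemma chord_ge0 z x : 0 <= z -> l * z <= x <= u * z -> 0 <= chord z x.
Proof.
move=> z0; apply: affine_ge0.
  by rewrite -/(chord _ _) chord_l mulr_ge0// -xi0 ltW// f_gt0.
by rewrite -/(chord _ _) chord_u mulr_ge0// -xin ltW// f_gt0.
Qed.

(** Both sides are linear and a tangent is below [f] at [l] and at [u]. *)
Lemma persp_tangent_le_chord i z x : (i <= n)%N -> 0 <= z ->
  l * z <= x <= u * z -> persp_tangent i z x <= chord z x.
Proof.
move=> i_n z0 xz; rewrite -subr_ge0.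
have chordE y : chord z y - persp_tangent i z y =
  ((f l - chord_slope * l) * z - (f (xi i) - f' (xi i) * xi i) * z)
    + (chord_slope - f' (xi i)) * y.
  by rewrite /chord /persp_tangent; ring.
have endE a : persp_tangent i z (a * z) = tangent i a * z.
  by rewrite /persp_tangent /tangent; ring.
rewrite chordE; apply: affine_ge0 xz; rewrite -chordE subr_ge0 endE.
  rewrite chord_l ler_wpM2r// -xi0; exact: tangent_le.
by rewrite chord_u ler_wpM2r// -xin; exact: tangent_le.
Qed.

(** A part of the polyhedral cone.  When [z] ranges over the half-open unit
    interval it is the perspective set; with the value 0 included, it is a closed
    polytope that exceeds the perspective set by the origin. *)
Definition slab (P : set R) : set (R * R * R) :=
  [set p | let: (x, y, z) := p in
    [/\ forall i, (i <= n)%N -> persp_tangent i z x <= y,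
        0 <= y <= chord z x, l * z <= x <= u * z & P z]].

Local Notation pset := (perspective_set l u g).

Lemma persp_itv z x : 0 < z -> (l * z <= x <= u * z) = (l <= x / z <= u).
Proof. by move=> z0; rewrite ler_pdivlMr// ler_pdivrMr. Qed.

Lemma perspective_setE : pset = slab `]0, 1].
Proof.
apply/seteqP; split => -[[x y] z]; rewrite /slab /perspective_set /=;
    rewrite under_estimator_l under_estimator_u in_itv/=.
  move=> [/andP[gy yc] xz z01 y0]; have z0 : 0 < z by case/andP: z01.
  have xzlu : l <= x / z <= u by rewrite -persp_itv.
  split => //; last by rewrite y0.
  move=> i i_n; rewrite persp_tangentE ?gt_eqF//.
  by apply: le_trans gy; rewrite ler_pM2l// under_estimator_ge.
move=> [gy /andP[y0 yc] xz z01]; have z0 : 0 < z by case/andP: z01.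
have xzlu : l <= x / z <= u by rewrite -persp_itv.
split => //; rewrite yc andbT.
have [j [jn _ ->]] := under_estimator_tangent _ xzlu.
by rewrite -persp_tangentE ?gt_eqF// gy.
Qed.

Lemma convex_slab01 : convex_set (slab `]0, 1]).
Proof.
move=> [[x1 y1] z1] [[x2 y2] z2] t; rewrite !inE /slab/= !in_itv/=.
move=> [T1 /andP[y10 yc1] /andP[lx1 xu1] /andP[z10 z11]].
move=> [T2 /andP[y20 yc2] /andP[lx2 xu2] /andP[z20 z21]].
have t0 : 0 <= t%:num by []. have t1 : 0 <= 1 - t%:num by rewrite subr_ge0.
rewrite /GRing.scale/= -![unstable.onem _]/(1 - _).
move: (t%:num) t0 t1 => {}t t0 t1.
have lin (a1 a2 b1 b2 : R) : a1 <= b1 -> a2 <= b2 ->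
    t * a1 + (1 - t) * a2 <= t * b1 + (1 - t) * b2.
  by move=> ab1 ab2; apply: lerD; rewrite ler_wpM2l.
split.
- move=> i i_n; apply: le_trans (lin _ _ _ _ (T1 i i_n) (T2 i i_n)).
  by rewrite /persp_tangent le_eqVlt; apply/orP; left; apply/eqP; ring.
- rewrite addr_ge0 ?mulr_ge0//=; apply: le_trans (lin _ _ _ _ yc1 yc2) _.
  by rewrite /chord le_eqVlt; apply/orP; left; apply/eqP; ring.
- have := lin _ _ _ _ lx1 lx2; have := lin _ _ _ _ xu1 xu2.
  by move=> *; apply/andP; split; lra.
- have := lin _ _ _ _ z11 z21; rewrite !mulr1 subrKC => ->; rewrite andbT.
  have [t00|tpos] := eqVneq t 0; first by rewrite t00 mul0r add0r subr0 mul1r.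
  by rewrite ltr_wpDr ?mulr_ge0 ?(ltW z20)// mulr_gt0// lt_neqAle eq_sym tpos.
Qed.

Definition halfspace (a b c d : R) : set (R * R * R) :=
  [set p | 0 <= a * p.1.1 + b * p.1.2 + c * p.2 + d].

Lemma closed_halfspace a b c d : closed (halfspace a b c d).
Proof.
apply: (@closed_comp _ _
  (fun p : R * R * R => a * p.1.1 + b * p.1.2 + c * p.2 + d) [set x | 0 <= x]).
  move=> p _; apply: cvgD; last exact: cvg_cst.
  apply: cvgD; [apply: cvgD|]; apply: cvgMr.
  - by apply: cvg_comp; [exact: cvg_fst|exact: cvg_fst].
  - by apply: cvg_comp; [exact: cvg_fst|exact: cvg_snd].
  - exact: cvg_snd.
exact: closed_ge.
Qed.

Lemma measurable_halfspace a b c d : measurable (halfspace a b c d).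
Proof.
rewrite /halfspace -[X in measurable X]setTI.
apply: (@measurable_fun_ler _ _ _ setT (fun=> 0)
  (fun p : R * R * R => a * p.1.1 + b * p.1.2 + c * p.2 + d)
  _ _ measurableT [set true]) => //.
apply: measurable_funD => //; apply: measurable_funD; [apply: measurable_funD|].
- by apply: measurable_funM => //; exact: measurableT_comp.
- by apply: measurable_funM => //; exact: measurableT_comp.
- exact: measurable_funM.
Qed.

Lemma slabE : slab `[0, 1] =
  (\bigcap_(i in `I_n.+1)
     halfspace (- f' (xi i)) 1 (- (f (xi i) - f' (xi i) * xi i)) 0)
  `&` (halfspace 0 1 0 0
  `&` halfspace chord_slope (- 1) (f l - chord_slope * l) 0
  `&` (halfspace 1 0 (- l) 0 `&` halfspace (- 1) 0 u 0)
  `&` (halfspace 0 0 1 0 `&` halfspace 0 0 (- 1) 1)).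
Proof.
apply/seteqP; split => -[[x y] z].
  rewrite /slab/= in_itv/= => -[T /andP[y0 yc] /andP[lx xu] /andP[z0 z1]].
  split.
    by move=> i /= i_n; have := T i i_n; rewrite /halfspace /persp_tangent/=; lra.
  move: yc; rewrite /halfspace /chord /= => yc.
  by split; [split; split|split]; lra.
rewrite /slab/halfspace/= in_itv/= => -[T [[[y0 yc] [lx xu]] [z0 z1]]].
split.
- by move=> i i_n; have := T i i_n; rewrite /persp_tangent/=; lra.
- by rewrite /chord; apply/andP; split; lra.
- by apply/andP; split; lra.
- by apply/andP; split; lra.
Qed.

Lemma closed_slab01 : closed (slab `[0, 1]).
Proof.
rewrite slabE; apply: closedI.
  by apply: closed_bigI => i _; exact: closed_halfspace.
by do ![apply: closedI|exact: closed_halfspace].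
Qed.

Lemma measurable_slab01 : measurable (slab `[0, 1]).
Proof.
rewrite slabE; apply: measurableI.
  by apply: fin_bigcap_measurable => // i _; exact: measurable_halfspace.
by do ![apply: measurableI|exact: measurable_halfspace].
Qed.

Lemma measurable_perspective : measurable pset.
Proof.
suff -> : pset = slab `[0, 1] `\` halfspace 0 0 (- 1) 0.
  by apply: measurableD; [exact: measurable_slab01|exact: measurable_halfspace].
rewrite perspective_setE; apply/seteqP; split => -[[x y] z];
    rewrite /slab /halfspace/= !in_itv/=.
  move=> [T yc xz /andP[z0 z1]]; split; first by rewrite (ltW z0).
  by apply/negP; rewrite -ltNge; lra.
move=> [[T yc xz /andP[z0 z1]] /negP]; rewrite -ltNge => zpos.
by split => //; rewrite z1 andbT; lra.
Qed.

(** At height 0 the bounds on [x] force [x = 0], and those on [y] then force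
    [y = 0]. *)
Lemma slab_apex : slab `[0, 1] `<=` pset `|` [set (0, 0, 0)].
Proof.
rewrite perspective_setE => -[[x y] z].
rewrite /slab/= !in_itv/= => -[T /andP[y0 yc] xz /andP[z0 z1]].
move: z0; rewrite le_eqVlt => /predU1P[z0|z0]; last first.
  by left; split; rewrite /= ?in_itv/= ?z0 ?y0.
right; move: yc xz; rewrite -z0 /chord !mulr0 add0r -eq_le => yc /eqP x0.
by move: y0 yc; rewrite -x0 mulr0 => *; congr (_, _, _); apply/le_anti/andP.
Qed.

Lemma U_relaxE : U_relax l u f f' n xi = closure pset.
Proof.
rewrite /U_relax /convex_closure smallest_id// perspective_setE.
exact: convex_slab01.
Qed.

Lemma closure_perspective_sub : closure pset `<=` slab `[0, 1].
Proof.
rewrite closureE => p; apply; split; first exact: closed_slab01.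
rewrite perspective_setE => -[[x y] z] [T yc xz].
by rewrite /= in_itv/= => /andP[z0 z1]; split => //; rewrite /= in_itv/= ltW.
Qed.

(** The closure lies between the perspective set and this set with the origin
    added, both measurable; so it is one of the two. *)
Lemma measurable_U_relax : measurable (U_relax l u f f' n xi).
Proof.
rewrite U_relaxE; have [U0|U0] := pselect (closure pset (0, 0, 0)).
  suff -> : closure pset = slab `[0, 1] by exact: measurable_slab01.
  apply/seteqP; split; first exact: closure_perspective_sub.
  by move=> p /slab_apex[/subset_closure//|->].
suff -> : closure pset = pset by exact: measurable_perspective.
apply/seteqP; split; last exact: subset_closure.
move=> p Up; have [//|p0] := slab_apex _ (closure_perspective_sub _ Up).
by move: Up; rewrite p0.
Qed.

Lemma U_relax_slab x y z : 0 < z <= 1 ->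
  U_relax l u f f' n xi (x, y, z) = slab `]0, 1] (x, y, z).
Proof.
move=> z01; rewrite U_relaxE; apply/propext.
split => [/closure_perspective_sub|].
  by move=> [T yc xz _]; split => //; rewrite /= in_itv.
by rewrite -perspective_setE => /subset_closure.
Qed.

(** * The area of a slice and the volume *)

Definition cell_area2_at (i : nat) : R :=
  cell_area2 (xi i) (f (xi i)) (f' (xi i)) (xi i.+1) (f (xi i.+1)) (f' (xi i.+1)).

(** The program branches on the order of the slopes, whereas [tau] branches on
    their equality; the slopes being nondecreasing, this is the same test. *)
Lemma cell_area2_atE i : (i < n)%N ->
  cell_area2_at i = ramp_area2 (tau i.+1 - xi i) (f (xi i)) (tangent i (tau i.+1))
    + ramp_area2 (xi i.+1 - tau i.+1) (f (xi i.+1)) (tangent i (tau i.+1)).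
Proof.
move=> i_n; have tE : tangent i (tau i.+1) = tangent i.+1 (tau i.+1).
  by apply/eqP; rewrite eq_sym -subr_eq0 tangentB// subrr mulr0.
rewrite tE /cell_area2_at /cell_area2; case: ifPn => [m10|]; last first.
  by rewrite -ltNge => m01; rewrite /tangent /Defs.tau/= ltnNge i_n/= lt_eqF.
(* equal slopes: [tau i.+1] is the midpoint, where the tangent is positive *)
have meq : f' (xi i) = f' (xi i.+1) by apply/le_anti; rewrite slope_le.
have F10 := tangentB i (xi i) i_n.
move: F10; rewrite meq subrr mul0r tangent_xi => /eqP; rewrite subr_eq0.
rewrite /tangent /Defs.tau/= ltnNge i_n/= meq eqxx => /eqP f01.
have f0 := f_gt0 _ (ltnW i_n); have f1 := f_gt0 _ i_n.
rewrite -f01 in f0 *.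
by rewrite /ramp_area2 !ifT; [field|lra|lra].
Qed.

Definition chord_int (z a b : R) : R :=
  (f l - chord_slope * l) * z * (b - a)
    + chord_slope * (b ^+ 2 - a ^+ 2) / 2.

Definition lower (z x : R) : R := Num.max 0 (z * g (x / z)).

(** On either side of [z * tau i.+1] the function [g] is the tangent at the
    adjacent linearization point, where its value is positive: the two sides are
    instances of [has_int_ramp_right] and [has_int_ramp_left]. *)
Lemma has_int_cell i z : (i < n)%N -> 0 < z ->
  has_int (fun x => chord z x - lower z x) (z * xi i) (z * xi i.+1)
    (chord_int z (z * xi i) (z * xi i.+1) - z ^+ 2 * cell_area2_at i / 2).
Proof.
move=> i_n z0; have /andP[xt tx] := tau_itv _ i_n.
have zx (a b x : R) : (z * a <= x <= z * b) = (a <= x / z <= b).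
  by rewrite ler_pdivlMr// ler_pdivrMr// ![z * _]mulrC.
have /andP[lx _] := xi_itv i (ltnW i_n). have /andP[_ xu] := xi_itv _ i_n.
have zn0 : z != 0 by rewrite gt_eqF.
rewrite cell_area2_atE//; set v := tangent i _.
rewrite [X in has_int _ _ _ X](_ : _ =
  (chord_int z (z * xi i) (z * tau i.+1)
    - z ^+ 2 * ramp_area2 (tau i.+1 - xi i) (f (xi i)) v / 2) +
  (chord_int z (z * tau i.+1) (z * xi i.+1)
    - z ^+ 2 * ramp_area2 (xi i.+1 - tau i.+1) (f (xi i.+1)) v / 2));
  last by rewrite /chord_int; field.
have hE j x : (j <= n)%N -> l <= x / z <= u -> tau j <= x / z <= tau j.+1 ->
    chord z x - lower z x = (f l - chord_slope * l) * z + chord_slope * x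
      - Num.max 0 ((f (xi j) - f' (xi j) * xi j) * z + f' (xi j) * x).
  move=> j_n xlu xj; rewrite /lower (under_estimatorE j)//.
  by rewrite -persp_tangentE.
have TE j a : z * tangent j a =
    (f (xi j) - f' (xi j) * xi j) * z + f' (xi j) * (z * a).
  by rewrite /tangent; ring.
rewrite /v /chord_int.
apply: (has_int_cat _ _ _ (z * tau i.+1)); rewrite ?ler_pM2l//.
  rewrite -ramp_area2_scale// (mulrBr z) -(tangent_xi i) !TE.
  apply: has_int_ramp_right;
    rewrite ?ler_pM2l// -?TE ?tangent_xi ?mulr_gt0 ?f_gt0 1?ltnW//.
  move=> x; rewrite zx => /andP[x1 x2]; apply: hE; rewrite 1?ltnW//.
    by rewrite (le_trans lx x1) (le_trans x2)// (le_trans tx).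
  by rewrite x2 andbT (le_trans _ x1)// tau_le_xi// ltnW.
have -> : tangent i (tau i.+1) = tangent i.+1 (tau i.+1).
  by apply/eqP; rewrite eq_sym -subr_eq0 tangentB// subrr mulr0.
rewrite -ramp_area2_scale// (mulrBr z) -(tangent_xi i.+1) !TE.
apply: has_int_ramp_left;
  rewrite ?ler_pM2l// -?TE ?tangent_xi ?mulr_gt0 ?f_gt0//.
move=> x; rewrite zx => /andP[x1 x2]; apply: hE => //.
  by rewrite (le_trans (le_trans lx xt) x1) (le_trans x2).
by rewrite x1 (le_trans x2)// xi_le_tauS.
Qed.

Lemma has_int_cells k z : (k <= n)%N -> 0 < z ->
  has_int (fun x => chord z x - lower z x) (z * xi 0%N) (z * xi k)
    (chord_int z (z * xi 0%N) (z * xi k)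
      - z ^+ 2 * (\sum_(i < k) cell_area2_at i) / 2).
Proof.
move=> + z0; elim: k => [_|k ih k_n].
  (* a degenerate interval, on which every function is constant *)
  pose h0 := chord z (z * xi 0%N) - lower z (z * xi 0%N).
  rewrite big_ord0 [X in has_int _ _ _ X](_ : _ =
    h0 * (z * xi 0%N - z * xi 0%N)
    + 0 * ((z * xi 0%N) ^+ 2 - (z * xi 0%N) ^+ 2) / 2);
    last by rewrite /chord_int; ring.
  apply: has_int_affine => // x; rewrite -eq_le => /eqP <-.
  by rewrite mul0r addr0.
rewrite big_ord_recr/= [X in has_int _ _ _ X](_ : _ =
  (chord_int z (z * xi 0%N) (z * xi k)
    - z ^+ 2 * (\sum_(i < k) cell_area2_at i) / 2) +
  (chord_int z (z * xi k) (z * xi k.+1) - z ^+ 2 * cell_area2_at k / 2));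
  last by rewrite /chord_int; field.
apply: (has_int_cat _ _ _ (z * xi k)); last exact: has_int_cell.
- by rewrite ler_pM2l// xi0; case/andP: (xi_itv k (ltnW k_n)).
- by rewrite ler_pM2l// ltW// xi_lt.
- exact: ih (ltnW k_n).
Qed.

(** Twice the area of the slice at height 1: the trapezoid under the chord minus
    the cells. *)
Definition volume_numerator : R :=
  (u - l) * (f l + f u) - \sum_(i < n) cell_area2_at i.

Lemma has_int_slice z : 0 < z ->
  has_int (fun x => chord z x - lower z x) (l * z) (u * z)
    (volume_numerator / 2 * z ^+ 2).
Proof.
move=> z0; have := has_int_cells n z (leqnn n) z0.
rewrite xi0 xin ![z * l]mulrC ![z * u]mulrC; congr has_int.
rewrite /volume_numerator /chord_int /chord_slope; field.
by rewrite subr_eq0 gt_eqF.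
Qed.

Local Notation mu := (@lebesgue_measure R).

Lemma lower_le_chord z x : 0 < z -> l * z <= x <= u * z ->
  lower z x <= chord z x.
Proof.
move=> z0 xz; rewrite /lower ge_max (chord_ge0 _ _ (ltW z0))//=.
have [|j [jn _ ->]] := under_estimator_tangent (x / z).
  by rewrite -persp_itv.
by rewrite -persp_tangentE ?gt_eqF// persp_tangent_le_chord// ltW.
Qed.

Lemma section_sectionE (A : set (R * R * R)) x y z :
  xsection (ysection A z) x y = A (x, y, z).
Proof. by rewrite /xsection /ysection/= inE/= inE. Qed.

Lemma section_U_relax z x : 0 < z <= 1 -> l * z <= x <= u * z ->
  xsection (ysection (U_relax l u f f' n xi) z) x =
    `[lower z x, chord z x]%classic.
Proof.
move=> z01 xz; have z0 : 0 < z by case/andP: z01.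
have xzlu : l <= x / z <= u by rewrite -persp_itv.
apply/seteqP; split => y; rewrite section_sectionE U_relax_slab//
  -perspective_setE /perspective_set/=.
all: rewrite in_itv/= /lower ge_max under_estimator_l under_estimator_u.
  by move=> [/andP[-> yc] _ _ ->].
by move=> /andP[/andP[y0 gy] yc]; split; rewrite ?gy.
Qed.

Lemma section_U_relax0 z x : 0 < z <= 1 -> ~~ (l * z <= x <= u * z) ->
  xsection (ysection (U_relax l u f f' n xi) z) x = set0.
Proof.
move=> z01 /negP xz; apply/seteqP; split => // y.
by rewrite section_sectionE U_relax_slab// => -[].
Qed.

Lemma slice_measure z : 0 < z <= 1 ->
  (mu \x mu)%E (ysection (U_relax l u f f' n xi) z) =
  (volume_numerator / 2 * z ^+ 2)%:E.
Proof.
move=> z01; have z0 : 0 < z by case/andP: z01.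
have [_ <-] := has_int_slice z z0.
rewrite /product_measure1 [RHS]integral_mkcond.
apply: eq_integral => x _ /=; rewrite patchE mem_setE in_itv/=.
case: ifPn => [xz|xz]; last by rewrite section_U_relax0// measure0.
rewrite section_U_relax// lebesgue_measure_itv/= lte_fin.
case: ltgtP (lower_le_chord _ _ z0 xz) => // -> _.
by rewrite subrr.
Qed.

(** The slices have area [volume_numerator / 2 * z ^ 2], and the integral of
    [z ^ 2] over [[0, 1]] is 1/3.  The slice at height 0 depends on whether the
    origin is in the relaxation, hence the passage to the open interval. *)
Lemma volume_U_relax :
  vol (U_relax l u f f' n xi) = (volume_numerator / 6)%:E.
Proof.
(* the sigma-algebra that comes with the Lebesgue measure *)
pose U : set (measurableTypeR R * measurableTypeR R * measurableTypeR R) :=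
  U_relax l u f f' n xi.
have mU : measurable U by exact: measurable_U_relax.
pose phi (z : measurableTypeR R) := (mu \x mu)%E (ysection U z).
have mphi : measurable_fun setT phi := measurable_slices _ _ _ mu U mU.
rewrite /vol (cube_measure_slices _ _ _ mu U mU) -/(phi _).
have phi0 z : ~~ (0 <= z <= 1) -> phi z = 0.
  move=> /negP zn; rewrite /phi (_ : ysection _ z = set0) ?measure0//.
  apply/seteqP; split => // -[x y]; rewrite /ysection/= inE /U U_relaxE.
  move=> /closure_perspective_sub[_ _ _].
  by rewrite /= in_itv.
rewrite [LHS](_ : _ = \int[mu]_(z in `[0%R, 1%R]) phi z)%E; last first.
  rewrite [RHS]integral_mkcond; apply: eq_integral => z _.
  rewrite patchE mem_setE in_itv/=; case: ifPn => // zn; exact: phi0.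
rewrite integral_itv_bndoo; last exact: measurable_funS mphi.
transitivity (\int[mu]_(z in `]0%R, 1%R[) (volume_numerator / 2 * z ^+ 2)%:E)%E.
  apply: eq_integral => z; rewrite inE/= in_itv/= => /andP[z0 z1].
  by rewrite /phi slice_measure ?z0 ?ltW.
have [mq iq] : has_int (fun z => volume_numerator / 2 * z ^+ 2) 0 1
    (volume_numerator / 6).
  rewrite [X in has_int _ _ _ X](_ : _ =
    0 * (1 - 0) + 0 * (1 ^+ 2 - 0 ^+ 2) / 2
    + volume_numerator / 2 * (1 ^+ 3 - 0 ^+ 3) / 3); last by field.
  by apply: has_int_quadratic => // x _; rewrite mul0r !add0r.
rewrite -iq -(@integral_itv_bndoo _ 0 1 _ true false)//.
apply/measurable_EFinP; apply: measurable_funS mq => //.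
exact: subset_itv_oo_cc.
Qed.

End Linearization.

(** * A linear-time program *)

(** At the head of the loop, index register 1 holds the number of cells added so
    far and 2 the constant 1; real register 0 holds the sum of their
    contributions and 9 the constant 0; registers 1 to 3 hold the data (abscissa,
    value, slope) at the left end of the next cell.  Registers 4 to 6 then receive
    those at its right end.  The numbers in the comments are the addresses of the
    instructions that follow. *)
Definition volume_program : program :=
  [:: ISet 1 0; ISet 2 1; MRead 1 1; QueryF 2 1; QueryF' 3 1;
  (* 5: head of the loop; load the right end, and compare the slopes *)
  IJumpLe 0 1 48; IAdd 1 1 2; MRead 4 1; QueryF 5 4; QueryF' 6 4;
  RSub 10 4 1; RJumpLe 6 3 41;
  (* 12: crossing point of the tangents, and the sign of its ordinate *)
  RMul 11 6 4; RSub 11 5 11; RMul 12 3 1; RSub 12 2 12; RSub 11 11 12;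
  RSub 12 3 6; RDiv 7 11 12; RSub 8 7 4; RMul 8 6 8; RAdd 8 5 8;
  RSub 10 7 1; RSub 11 4 7; RJumpLe 9 8 35;
  (* 25: two triangles *)
  RMul 12 2 2; RMul 10 10 12; RSub 12 2 8; RDiv 10 10 12;
  RMul 12 5 5; RMul 11 11 12; RSub 12 5 8; RDiv 11 11 12;
  RAdd 10 10 11; IJumpLe 2 2 43;
  (* 35: two trapezoids *)
  RAdd 12 2 8; RMul 10 10 12; RAdd 12 5 8; RMul 11 11 12;
  RAdd 10 10 11; IJumpLe 2 2 43;
  (* 41: equal slopes, one trapezoid *)
  RAdd 11 2 5; RMul 10 10 11;
  (* 43: add register 10; the right end becomes the left end *)
  RAdd 0 0 10; MRead 1 1; QueryF 2 1; QueryF' 3 1; IJumpLe 2 2 5;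
  (* 48: subtract the sum from the trapezoid under the chord *)
  ISet 1 0; MRead 4 1; QueryF 5 4; RSub 10 1 4; RAdd 11 5 2; RMul 10 10 11;
  RSub 0 10 0; RSet 10 6; RDiv 0 0 10; Halt].

Section Execution.
Variables (R : realType) (f f' : R -> R).

Definition reaches (b : nat) (st : state R) (Q : state R -> Prop) : Prop :=
  exists k st', [/\ (k <= b)%N, run f f' volume_program k st = Some st' & Q st'].

Lemma reaches_now b st (Q : state R -> Prop) : Q st -> reaches b st Q.
Proof. by exists 0%N, st. Qed.

Lemma reaches_le b b' st Q : (b <= b')%N -> reaches b st Q -> reaches b' st Q.
Proof.
move=> bb' [k [st' [kb runE Qst]]]; exists k, st'; split => //.
exact: leq_trans bb'.
Qed.

Lemma reaches_step b st st1 Q :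
  step f f' volume_program st = Some st1 -> reaches b st1 Q ->
  reaches b.+1 st Q.
Proof.
by move=> stE [k [st' [kb runE Qst]]]; exists k.+1, st'; rewrite /= stE.
Qed.

Lemma run_add k1 k2 st : run f f' volume_program (k1 + k2) st =
  obind (run f f' volume_program k2) (run f f' volume_program k1 st).
Proof.
elim: k1 st => // k1 ih st /=.
by case: (step f f' volume_program st) => //= st1; rewrite ih.
Qed.

Lemma reaches_trans b1 b2 st Q Q' : reaches b1 st Q ->
  (forall st', Q st' -> reaches b2 st' Q') -> reaches (b1 + b2) st Q'.
Proof.
move=> [k1 [st1 [kb1 run1 Q1]]] /(_ st1 Q1)[k2 [st2 [kb2 run2 Q2]]].
by exists (k1 + k2)%N, st2; rewrite leq_add// run_add run1.
Qed.

Variables (n : nat) (xi : nat -> R).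

Local Notation cell_area2_at i := (cell_area2 (xi i) (f (xi i)) (f' (xi i))
  (xi i.+1) (f (xi i.+1)) (f' (xi i.+1))).

(** The machine is at address [p], its counter is [i], and the real registers
    listed in [vals] have the given values.  Such partial descriptions between
    short runs of instructions keep the symbolic states small. *)
Definition stage (p i : nat) (vals : seq (nat * R)) (st : state R) : Prop :=
  exists I X M,
   [/\ st = State p I X M,
       [/\ I 0%N = n, I 1%N = i & I 2 = 1%N],
       foldr (fun av Q => X av.1 = av.2 /\ Q) True vals &
       forall k, (k <= n)%N -> M k = xi k].

Let tangent_cross (i : nat) : R :=
  ((f (xi i.+1) - f' (xi i.+1) * xi i.+1) - (f (xi i) - f' (xi i) * xi i))
    / (f' (xi i) - f' (xi i.+1)).

Let cross_value (i : nat) : R :=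
  f (xi i.+1) + f' (xi i.+1) * (tangent_cross i - xi i.+1).

Local Notation vars i := [:: (0%N, \sum_(j < i) cell_area2_at j); (9, 0)].
Local Notation left_end i := [:: (1%N, xi i); (2, f (xi i)); (3, f' (xi i))].

Definition at_head i := stage 5 i (vars i ++ left_end i).

Definition at_loaded i := stage 11 i.+1 (vars i ++ left_end i ++
  [:: (4, xi i.+1); (5, f (xi i.+1)); (6, f' (xi i.+1));
      (10, xi i.+1 - xi i)]).

Definition at_crossed i := stage 24 i.+1 (vars i ++
  [:: (2, f (xi i)); (5, f (xi i.+1)); (8, cross_value i);
      (10, tangent_cross i - xi i); (11, xi i.+1 - tangent_cross i)]).

Definition at_added i := stage 43 i.+1 (vars i ++ [:: (10, cell_area2_at i)]).

(** Jumps and divisions do not reduce by computation alone: the outcome of a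
    test, or that a divisor is nonzero, has to be supplied. *)
Lemma reaches_ijump b i j t c st Q :
  onth volume_program (pc st) = Some (IJumpLe i j t) ->
  (ireg st i <= ireg st j)%N = c ->
  reaches b (jump_if c t st) Q -> reaches b.+1 st Q.
Proof. by move=> stE <-; apply: reaches_step; rewrite /step stE. Qed.

Lemma reaches_rjump b i j t c st Q :
  onth volume_program (pc st) = Some (RJumpLe i j t) ->
  (rreg st i <= rreg st j) = c ->
  reaches b (jump_if c t st) Q -> reaches b.+1 st Q.
Proof. by move=> stE <-; apply: reaches_step; rewrite /step stE. Qed.

Lemma reaches_div k a b c st Q :
  onth volume_program (pc st) = Some (RDiv a b c) -> rreg st c != 0 ->
  reaches k (set_rreg a (rreg st b / rreg st c) st) Q -> reaches k.+1 st Q.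
Proof.
by move=> stE c0; apply: reaches_step; rewrite /step stE (negbTE c0).
Qed.

Ltac fetch := cbn; reflexivity.
Ltac exec := eapply reaches_step; [fetch | cbn].
Ltac finish := apply: reaches_now; do 3 eexists; split; [reflexivity|..].

Hypothesis f_gt0 : forall i, (i <= n)%N -> 0 < f (xi i).

Lemma reach_head : reaches 5 (init n xi) (at_head 0).
Proof.
rewrite /init; set M := (fun k => if (k <= n)%N then xi k else 0).
have ME k : (k <= n)%N -> M k = xi k by rewrite /M => ->.
move: M ME => M ME.
do 5 exec; finish; rewrite /= ?ME//.
by rewrite big_ord0.
Qed.

Lemma head_loaded i st : (i < n)%N -> at_head i st ->
  reaches 6 st (at_loaded i).
Proof.
move=> i_n [I [X [M [-> [I0 I1 I2] [X0 [X9 [X1 [X2 [X3 _]]]]] ME]]]].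
eapply reaches_ijump; first fetch.
  by rewrite /= I0 I1 leqNgt i_n; reflexivity.
cbn; do 5 exec; finish; rewrite /= ?I1 ?I2 ?addn1// ME//.
by rewrite X1.
Qed.

Lemma loaded_added i st : f' (xi i.+1) <= f' (xi i) -> at_loaded i st ->
  reaches 3 st (at_added i).
Proof.
move=> m10 [I [X [M [-> [I0 I1 I2]
  [X0 [X9 [X1 [X2 [X3 [X4 [X5 [X6 [X10 _]]]]]]]]] ME]]]].
eapply reaches_rjump; first fetch.
  by rewrite /= X6 X3 m10; reflexivity.
cbn; do 2 exec; finish; rewrite //= /cell_area2 m10.
by rewrite X10 X2 X5.
Qed.

Lemma loaded_crossed i st : f' (xi i) < f' (xi i.+1) -> at_loaded i st ->
  reaches 13 st (at_crossed i).
Proof.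
move=> m01 [I [X [M [-> [I0 I1 I2]
  [X0 [X9 [X1 [X2 [X3 [X4 [X5 [X6 _]]]]]]]] ME]]]].
eapply reaches_rjump; first fetch.
  by rewrite /= X6 X3 leNgt m01; reflexivity.
cbn; do 6 exec.
eapply reaches_div; first fetch.
  by rewrite /= X6 X3 subr_eq0 lt_eqF.
cbn; do 5 exec; finish; rewrite //= X1 X2 X3 X4 X5 X6.
by rewrite /cross_value.
Qed.

Lemma cell_area2_crossed i : f' (xi i) < f' (xi i.+1) -> cell_area2_at i =
  ramp_area2 (tangent_cross i - xi i) (f (xi i)) (cross_value i) +
  ramp_area2 (xi i.+1 - tangent_cross i) (f (xi i.+1)) (cross_value i).
Proof. by move=> m01; rewrite /cell_area2 leNgt m01. Qed.

(** The divisions occur when the ordinate at the crossing point is negative; the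
    divisors are then positive because [f] is. *)
Lemma crossed_added i st : (i < n)%N -> f' (xi i) < f' (xi i.+1) ->
  at_crossed i st -> reaches 11 st (at_added i).
Proof.
move=> i_n m01 [I [X [M [-> [I0 I1 I2]
  [X0 [X9 [X2 [X5 [X8 [X10 [X11 _]]]]]]] ME]]]].
have [v0|v0] := leP 0 (cross_value i).
  eapply reaches_rjump; first fetch.
    by rewrite /= X9 X8 v0; reflexivity.
  cbn; do 5 exec.
  eapply reaches_ijump; [fetch|exact: leqnn|].
  finish; rewrite //= cell_area2_crossed// /ramp_area2 v0.
  by rewrite X2 X5 X8 X10 X11.
have fv j : (j <= n)%N -> f (xi j) - cross_value i != 0.
  by move=> jn; rewrite subr_eq0 gt_eqF// (lt_trans v0)// f_gt0.
eapply reaches_rjump; first fetch.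
  by rewrite /= X9 X8 leNgt v0; reflexivity.
cbn; do 3 exec.
eapply reaches_div; first fetch.
  by rewrite /= X2 X8; exact: fv (ltnW i_n).
cbn; do 3 exec.
eapply reaches_div; first fetch.
  by rewrite /= X5 X8; exact: fv i_n.
cbn; do 1 exec.
eapply reaches_ijump; [fetch|exact: leqnn|].
finish; rewrite //= cell_area2_crossed// /ramp_area2 leNgt v0/=.
by rewrite X2 X5 X8 X10 X11.
Qed.

Lemma added_head i st : (i < n)%N -> at_added i st ->
  reaches 5 st (at_head i.+1).
Proof.
move=> i_n [I [X [M [-> [I0 I1 I2] [X0 [X9 [X10 _]]] ME]]]].
do 4 exec.
eapply reaches_ijump; [fetch|exact: leqnn|].
finish; rewrite //= I1 ME//.
by rewrite big_ord_recr/= X0 X10.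
Qed.

(** The longest way round the loop is the one through the two triangles:
    [6 + 13 + 11 + 5] steps. *)
Lemma reach_head_next i st : (i < n)%N -> at_head i st ->
  reaches 35 st (at_head i.+1).
Proof.
move=> i_n hd; rewrite -[35%N]/(6 + 24 + 5)%N.
apply: (reaches_trans _ _ _ (at_added i)) => [|st'];
  last exact: added_head.
apply: (reaches_trans _ _ _ (at_loaded i)) => [|{hd}{}st ld];
  first exact: head_loaded.
have [m10|m01] := leP (f' (xi i.+1)) (f' (xi i)).
  by apply: (reaches_le 3) => //; exact: loaded_added.
rewrite -[24%N]/(13 + 11)%N.
apply: (reaches_trans _ _ _ (at_crossed i)) => [|st'];
  [exact: loaded_crossed|exact: crossed_added].
Qed.

Lemma reach_head_all i : (i <= n)%N ->
  reaches (5 + 35 * i) (init n xi) (at_head i).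
Proof.
elim: i => [_|i ih i_n]; first by rewrite muln0; exact: reach_head.
rewrite mulnS addnCA addnC.
apply: (reaches_trans _ _ _ (at_head i)) => [|st]; first exact: ih (ltnW i_n).
exact: reach_head_next.
Qed.

Lemma computes_volume : (0 < n)%N ->
  computes_within f f' volume_program n xi (50 * n)
    (((xi n - xi 0%N) * (f (xi 0%N) + f (xi n)) - \sum_(i < n) cell_area2_at i) / 6).
Proof.
move=> n_gt0.
suff [k [st [kb runE [haltE rE]]]] : reaches (5 + 35 * n + 10) (init n xi)
    (fun st => onth volume_program (pc st) = Some Halt /\ rreg st 0%N =
      ((xi n - xi 0%N) * (f (xi 0%N) + f (xi n)) - \sum_(i < n) cell_area2_at i) / 6).
  exists k, st; split => //; apply: (leq_trans kb).
  (* [15 + 35 n <= 50 n], since there is at least one cell *)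
  by rewrite addnAC -[50%N]/(15 + 35)%N mulnDl leq_add2r leq_pmulr.
apply: (reaches_trans _ _ _ (at_head n)) => [|st'];
  first exact: reach_head_all.
move=> [I [X [M [-> [I0 I1 I2] [X0 [X9 [X1 [X2 _]]]] ME]]]].
eapply reaches_ijump; first fetch.
  by rewrite /= I0 I1 leqnn; reflexivity.
cbn; do 8 exec.
eapply reaches_div; first fetch.
  by rewrite /= pnatr_eq0.
apply: reaches_now; split => //.
by rewrite /= ME// X0 X1 X2.
Qed.

End Execution.

(* The values of f outside [l, u], and those of f' away from the linearization
   points, are unconstrained: the program and the time bound cannot depend on
   them. *)
Theorem corollary2p2 :
  exists (P : program) (C : nat),
  forall (R : realType) (l u : R) (f f' : R -> R) (n : nat) (xi : nat -> R),
    0 <= l -> l < u ->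
    convex_function (`[l, u] : set R) f ->
    (forall x, x \in `[l, u] -> 0 < f x) ->
    (1 <= n)%N ->
    xi 0%N = l -> xi n = u ->
    (forall i, (i < n)%N -> xi i < xi i.+1) ->
    (forall i, (i <= n)%N -> is_derive_on `[l, u] f (xi i) (f' (xi i))) ->
    exists v : R,
      vol (U_relax l u f f' n xi) = v%:E /\
      computes_within f f' P n xi (C * n) v.
Proof.
exists volume_program, 50%N => R l u f f' n xi _ lu f_convex f_gt0 n_gt0.
move=> xi0 xin xi_lt f_derive.
have xi_lu i : (i <= n)%N -> xi i \in `[l, u].
  by move=> i_n; rewrite in_itv/= (xi_itv _ _ _ _ _ xi0 xin xi_lt).
have tangent_le i j : (i <= n)%N -> (j <= n)%N ->
    tangent R f f' xi i (xi j) <= f (xi j).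
  by move=> i_n j_n; apply: (tangent_below _ l u) => //;
    [exact: f_derive|exact: xi_lu|exact: xi_lu].
have f_xi_gt0 i : (i <= n)%N -> 0 < f (xi i) by move=> /xi_lu/f_gt0.
exists (volume_numerator R l u f f' n xi / 6); split.
  exact: volume_U_relax.
rewrite /volume_numerator -xi0 -xin.
exact: computes_volume.
Qed.
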